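(* Let $\ell>0$, let $a,b>0$ be constants, let $f$ be a continuous function on $[0,\ell]$, and let $w$ be the solution of the boundary value problem $$a\,w(x)-b\,w''(x)=f(x),\quad x\in[0,\ell],\qquad w(0)=w(\ell)=0.$$ Suppose $w\in C^{p+1}([0,\ell])$ with an integer $p\ge1$. Let $w_N(x)=a_1\phi_1(x)+\dots+a_N\phi_N(x)$, where the coefficients $a_m$ $(m=1,\dots,N)$ are determined by solving the Ritz–Galerkin system for this problem with basis functions $\phi_1,\dots,\phi_N$ given in the context. Then there is a constant $c>0$, independent of $N$, such that $$\max_{0\le x\le\ell}|w_N(x)-w(x)|\le\sqrt{\frac{\ell}{2}}\;\frac{b_2\,c}{N^{p-1/2}},\qquad b_2=\sqrt{1+\frac{a\ell^2}{b\pi^2}}.$$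
   Context: $(\cdot,\cdot)$ is the inner product of $L^2(0,\ell)$. In the application, $(a,b)=(1,\tau^2q_{k,N}/2)$ or $(a,b)=(1+\tau^2\delta/2,\tau^2\gamma/2)$ with $\tau,q_{k,N},\gamma,\delta>0$. Basis functions: let $P_m$ be the standard Legendre polynomial of degree $m$ on $[-1,1]$, $\widetilde P_m(x)=P_m\left(\frac{2x}{\ell}-1\right)$, $A_m=1/\sqrt{2m+1}$, and $\widehat P_m(x)=\frac{1}{A_m\sqrt\ell}\widetilde P_m(x)$ the orthonormal shifted Legendre polynomial on $[0,\ell]$. Then $\phi_m(x)=\int_0^x\widehat P_m(s)\,ds$, $m=1,2,\dots$. Ritz–Galerkin system: the linear system $b\,(w_N',\phi_m')+a\,(w_N,\phi_m)=(f,\phi_m)$, $m=1,\dots,N$, for the coefficients of $w_N$; equivalently $w_N$ minimizes $I(w)=\int_0^\ell\left(b\,w'^2+a\,w^2-2fw\right)dx$ over the span of $\phi_1,\dots,\phi_N$. *)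

(* Defs.v *)
From Stdlib Require Import Reals.
From Coquelicot Require Import Coquelicot.
Open Scope R_scope.

Definition seg (l x : R) : Prop := 0 <= x <= l.

(* [D_in] and [continue_in] are relative to the set [seg l], so at the two
   endpoints they are one-sided; values outside [0,l] are irrelevant. *)
Definition derivative_on (l : R) (g g' : R -> R) : Prop :=
  forall x : R, seg l x -> D_in g g' (seg l) x.

Definition continuous_on_seg (l : R) (g : R -> R) : Prop :=
  forall x : R, seg l x -> continue_in g (seg l) x.

(* w is in C^k([0,l]); on [0,l], d i is the i-th derivative of w. *)
Definition C_k (l : R) (k : nat) (w : R -> R) : Prop :=
  exists d : nat -> R -> R,
    (forall x : R, seg l x -> d 0%nat x = w x) /\
    (forall i : nat, (i < k)%nat -> derivative_on l (d i) (d (S i))) /\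
    (forall i : nat, (i <= k)%nat -> continuous_on_seg l (d i)).

Definition solves_bvp (l a b : R) (f w : R -> R) : Prop :=
  (exists w1 w2 : R -> R,
      derivative_on l w w1 /\ derivative_on l w1 w2 /\
      forall x : R, seg l x -> a * w x - b * w2 x = f x) /\
  w 0 = 0 /\ w l = 0.

(* Bonnet's recurrence: (k+1) P_{k+1}(x) = (2k+1) x P_k(x) - k P_{k-1}(x). *)
Fixpoint legendre (m : nat) (x : R) : R :=
  match m with
  | O => 1
  | S k =>
      match k with
      | O => x
      | S j =>
          ((2 * INR k + 1) * x * legendre k x - INR k * legendre j x)
          / INR (S k)
      end
  end.

Definition legendre_shift (l : R) (m : nat) (x : R) : R :=
  legendre m (2 * x / l - 1).

Definition A_ (m : nat) : R := 1 / sqrt (2 * INR m + 1).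

Definition legendre_hat (l : R) (m : nat) (x : R) : R :=
  1 / (A_ m * sqrt l) * legendre_shift l m x.

Definition phi (l : R) (m : nat) (x : R) : R := RInt (legendre_hat l m) 0 x.

(* The L^2(0,l) inner product, applied below only to functions that are
   continuous on [0,l], where it is a Riemann integral. *)
Definition inner (l : R) (g h : R -> R) : R := RInt (fun x => g x * h x) 0 l.

(* Only the coefficients al 1, ..., al N are used. *)
Definition trial (l : R) (N : nat) (al : nat -> R) (x : R) : R :=
  sum_n_m (fun m => al m * phi l m x) 1 N.

Definition ritz_galerkin (l a b : R) (f : R -> R) (N : nat) (al : nat -> R)
  : Prop :=
  forall m : nat, (1 <= m <= N)%nat ->
    b * inner l (Derive (trial l N al)) (Derive (phi l m))
    + a * inner l (trial l N al) (phi l m)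
    = inner l f (phi l m).

Definition b2 (l a b : R) : R := sqrt (1 + a * l ^ 2 / (b * PI ^ 2)).

(* Main.v *)
Require Import Defs.
From Stdlib Require Import Reals Lra Lia Arith.
From Coquelicot Require Import Coquelicot.
Open Scope R_scope.

(** The error e = w_N - w vanishes at 0, so Cauchy-Schwarz gives
    e(x)^2 <= l * ||e'||^2 ([value_sq_le_energy]), and it suffices to bound e' in
    L^2.  Galerkin orthogonality makes w_N the best approximation of w in the
    energy norm ([cea]); comparing it with the combination of the phi_m whose
    derivative is the Legendre projection of w', and using Poincare's inequality,
    one finds that ||e'||^2 is at most a constant times the squared distance of
    w' to the polynomials of degree at most N ([energy_bound]).  Here w' has no
    component along the constants because w(0) = w(l) = 0.

    For u in C^k that squared distance is O(N^(-2k)) ([remainder_rate]).  One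
    derivative is gained as follows ([jackson]).  The Legendre polynomials are
    eigenfunctions of -(x(l-x) u')' with eigenvalues m(m+1), so their derivatives
    are orthogonal for the weight x(l-x), and the coefficient of u' along the
    m-th derivative is the Legendre coefficient of u.  Bessel's inequality for u'
    in the weighted space therefore bounds the sum of m(m+1) c_m^2, hence bounds
    any finite stretch of the sum of the c_m^2 beyond N by
    (N+1)^(-1) (N+2)^(-1) times the weighted energy of u'.  What lies beyond that stretch
    tends to 0, since Bernstein polynomials approximate u uniformly
    ([remainder_vanishes]).  Applying this to u minus a primitive of the
    projection of u' ([remainder_improve]) yields the rate by induction on k.

    With u = w' in C^p this gives the error bound O(N^(-p)), which is stronger
    than the rate claimed.  To avoid one-sided derivatives, w is replaced
    throughout by an extension to the whole line that is as smooth as w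
    ([smooth_extension]). *)

(** * Continuous functions and their integrals *)

Definition cont (g : R -> R) : Prop := forall x : R, continuous g x.

Lemma cont_const c : cont (fun _ => c).
Proof. intro x. apply continuous_const. Qed.

Lemma cont_id : cont (fun x => x).
Proof. intro x. apply continuous_id. Qed.

Lemma cont_plus f g : cont f -> cont g -> cont (fun x => f x + g x).
Proof. intros hf hg x. exact (continuous_plus f g x (hf x) (hg x)). Qed.

Lemma cont_minus f g : cont f -> cont g -> cont (fun x => f x - g x).
Proof. intros hf hg x. exact (continuous_minus f g x (hf x) (hg x)). Qed.

Lemma cont_mult f g : cont f -> cont g -> cont (fun x => f x * g x).
Proof. intros hf hg x. exact (continuous_mult f g x (hf x) (hg x)). Qed.

Lemma cont_derivable (g g' : R -> R) : (forall x, is_derive g x (g' x)) -> cont g.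
Proof.
  intros h x. apply (ex_derive_continuous g x). exists (g' x). apply h.
Qed.

Lemma cont_ext f g : (forall x, f x = g x) -> cont f -> cont g.
Proof. intros h hf x. apply continuous_ext with f; auto. Qed.

Create HintDb cont.

Ltac cont_tac :=
  lazymatch goal with
  | |- cont (fun x => _ + _) => apply cont_plus; cont_tac
  | |- cont (fun x => _ - _) => apply cont_minus; cont_tac
  | |- cont (fun x => _ * _) => apply cont_mult; cont_tac
  | |- cont (fun x => x) => apply cont_id
  | |- cont (Rminus ?a) => apply (cont_minus (fun _ => a)); cont_tac
  | |- cont (Rmult ?a) => apply (cont_mult (fun _ => a)); cont_tac
  | |- _ => first [assumption | apply cont_const | solve [auto with cont]]
  end.

Lemma is_derive_Rplus (f g : R -> R) x df dg : is_derive f x df -> is_derive g x dg ->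
  is_derive (fun y => f y + g y) x (df + dg).
Proof. exact (is_derive_plus f g x df dg). Qed.

Lemma is_derive_Rminus (f g : R -> R) x df dg : is_derive f x df -> is_derive g x dg ->
  is_derive (fun y => f y - g y) x (df - dg).
Proof. exact (is_derive_minus f g x df dg). Qed.

Lemma is_derive_Rscal c (f : R -> R) x df : is_derive f x df ->
  is_derive (fun y => c * f y) x (c * df).
Proof. exact (is_derive_scal f x c df). Qed.

Lemma is_derive_Rmult (f g : R -> R) x df dg : is_derive f x df -> is_derive g x dg ->
  is_derive (fun y => f y * g y) x (df * g x + f x * dg).
Proof. intros hf hg. apply (is_derive_mult f g x df dg hf hg). intros; apply Rmult_comm. Qed.

Lemma ex_RInt_cont g a b : cont g -> ex_RInt g a b.
Proof. intro h. apply (ex_RInt_continuous g). intros; apply h. Qed.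

Lemma RInt_derivative (g g' : R -> R) a b :
  (forall x, is_derive g x (g' x)) -> cont g' -> RInt g' a b = g b - g a.
Proof.
  intros h h'. apply is_RInt_unique.
  apply (is_RInt_derive g g'); intros; [apply h | apply h'].
Qed.

Lemma is_derive_primitive g c0 a x :
  cont g -> is_derive (fun y => c0 + RInt g a y) x (g x).
Proof.
  intro h.
  evar_last.
  - apply @is_derive_plus; [apply @is_derive_const|].
    apply (is_derive_RInt g (fun y => RInt g a y) a x); [|apply h].
    apply filter_forall. intro y. apply (@RInt_correct R_CompleteNormedModule).
    apply ex_RInt_cont; exact h.
  - unfold plus, zero; simpl. ring.
Qed.

(** * Weighted inner products *)

(** Weighted inner product; the weight is 1 for the Legendre polynomials and x(l-x)
    for their derivatives. *)
Definition wip (l : R) (rho g h : R -> R) : R :=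
  RInt (fun x => rho x * g x * h x) 0 l.

Definition unit_weight (x : R) : R := 1.

Lemma cont_unit_weight : cont unit_weight.
Proof. apply cont_const. Qed.
#[export] Hint Resolve cont_unit_weight : cont.

Definition sqnorm (l : R) (g : R -> R) : R := wip l unit_weight g g.

Lemma inner_weighted l g h : inner l g h = wip l unit_weight g h.
Proof.
  apply RInt_ext. intros x _. unfold unit_weight.
  change ((g x * h x) = 1 * g x * h x). ring.
Qed.

Lemma wip_ext l rho g h g1 h1 : 0 <= l ->
  (forall x, 0 < x < l -> g x = g1 x) -> (forall x, 0 < x < l -> h x = h1 x) ->
  wip l rho g h = wip l rho g1 h1.
Proof.
  intros hl hg hh. apply RInt_ext. intros x hx.
  rewrite Rmin_left, Rmax_right in hx by exact hl.
  rewrite hg, hh by exact hx. reflexivity.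
Qed.

Lemma wip_sym l rho g h : wip l rho g h = wip l rho h g.
Proof.
  apply RInt_ext. intros x _.
  change (rho x * g x * h x = rho x * h x * g x). ring.
Qed.

Lemma RInt_lin F c G a b : cont F -> cont G ->
  RInt (fun x => F x + c * G x) a b = RInt F a b + c * RInt G a b.
Proof.
  intros hF hG. apply is_RInt_unique.
  apply (@is_RInt_plus R_NormedModule F (fun x => c * G x)).
  - apply (@RInt_correct R_CompleteNormedModule), ex_RInt_cont; exact hF.
  - apply (@is_RInt_scal R_NormedModule G).
    apply (@RInt_correct R_CompleteNormedModule), ex_RInt_cont; exact hG.
Qed.

Lemma wip_lin_l l rho f c g h : cont rho -> cont f -> cont g -> cont h ->
  wip l rho (fun x => f x + c * g x) h = wip l rho f h + c * wip l rho g h.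
Proof.
  intros. unfold wip. rewrite <- RInt_lin by cont_tac.
  apply RInt_ext. intros x _.
  change (rho x * (f x + c * g x) * h x
          = rho x * f x * h x + c * (rho x * g x * h x)). ring.
Qed.

Lemma wip_lin_r l rho f c g h : cont rho -> cont f -> cont g -> cont h ->
  wip l rho h (fun x => f x + c * g x) = wip l rho h f + c * wip l rho h g.
Proof.
  intros. rewrite wip_sym, wip_lin_l, (wip_sym l rho f), (wip_sym l rho g); auto.
Qed.

Lemma wip_square l rho f c g : cont rho -> cont f -> cont g ->
  wip l rho (fun x => f x + c * g x) (fun x => f x + c * g x)
  = wip l rho f f + 2 * c * wip l rho f g + c ^ 2 * wip l rho g g.
Proof.
  intros. rewrite wip_lin_l, !wip_lin_r by cont_tac.
  rewrite (wip_sym l rho g f). ring.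
Qed.

Lemma wip_le l rho f g h k : 0 <= l -> cont rho -> cont f -> cont g -> cont h -> cont k ->
  (forall x, 0 < x < l -> rho x * f x * g x <= h x * k x) ->
  wip l rho f g <= wip l unit_weight h k.
Proof.
  intros. apply RInt_le; auto; try (apply ex_RInt_cont; cont_tac).
  intros x hx. unfold unit_weight. rewrite Rmult_1_l. auto.
Qed.

Lemma wip_nonneg l rho g : 0 <= l -> cont rho -> cont g ->
  (forall x, 0 < x < l -> 0 <= rho x) -> 0 <= wip l rho g g.
Proof.
  intros. unfold wip.
  replace 0 with (RInt (fun _ : R => 0) 0 l) at 1.
  - apply RInt_le; auto; try (apply ex_RInt_cont; cont_tac).
    intros x hx. pose proof (H2 x hx). pose proof (Rle_0_sqr (g x)). unfold Rsqr in *.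
    rewrite Rmult_assoc. now apply Rmult_le_pos.
  - rewrite RInt_const. unfold scal; simpl. unfold mult; simpl. ring.
Qed.

Lemma sqnorm_nonneg l g : 0 <= l -> cont g -> 0 <= sqnorm l g.
Proof. intros. apply wip_nonneg; auto with cont. intros; unfold unit_weight; lra. Qed.

(** The boundary conditions cover both uses: a factor x(l-x) in the weighted
    setting, and a factor phi_m in the weak form of the differential equation. *)
Lemma wip_by_parts l (f f' g g' : R -> R) :
  (forall x, is_derive f x (f' x)) -> (forall x, is_derive g x (g' x)) ->
  cont f' -> cont g' -> f 0 * g 0 = 0 -> f l * g l = 0 ->
  wip l unit_weight f' g = - wip l unit_weight f g'.
Proof.
  intros hf hg cf' cg' h0 hL.
  assert (cf := cont_derivable _ _ hf). assert (cg := cont_derivable _ _ hg).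
  assert (E : RInt (fun x => f' x * g x + f x * g' x) 0 l = f l * g l - f 0 * g 0).
  { apply (RInt_derivative (fun x => f x * g x)); [|cont_tac].
    intro x. apply (is_derive_mult f g); auto. intros; apply Rmult_comm. }
  rewrite h0, hL, Rminus_0_r in E.
  enough (wip l unit_weight f' g + wip l unit_weight f g' = 0) by lra.
  rewrite <- E. unfold wip.
  rewrite <- (RInt_plus (V := R_CompleteNormedModule)) by (apply ex_RInt_cont; cont_tac).
  apply RInt_ext. intros x _. unfold plus, unit_weight; simpl. ring.
Qed.

Lemma wip_scal_l l rho c g h : cont rho -> cont g -> cont h ->
  wip l rho (fun x => c * g x) h = c * wip l rho g h.
Proof.
  intros. transitivity (RInt (fun _ => 0) 0 l + c * wip l rho g h).
  - unfold wip. rewrite <- RInt_lin by cont_tac. apply RInt_ext. intros x _.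
    change (rho x * (c * g x) * h x = 0 + c * (rho x * g x * h x)). ring.
  - rewrite RInt_const. unfold scal; simpl; unfold mult; simpl. ring.
Qed.

Lemma wip_scal_r l rho c g h : cont rho -> cont g -> cont h ->
  wip l rho g (fun x => c * h x) = c * wip l rho g h.
Proof. intros. rewrite wip_sym, wip_scal_l, wip_sym by cont_tac. reflexivity. Qed.

(** Cauchy-Schwarz for g(x) = int_0^x g', obtained by integrating over [0,x] the
    square of g' minus its mean. *)
Lemma value_sq_le_energy l (g g' : R -> R) x :
  (forall x, is_derive g x (g' x)) -> cont g' -> 0 <= x -> x <= l -> g 0 = 0 ->
  (g x) ^ 2 <= l * sqnorm l g'.
Proof.
  intros hg cg' hx hxl g0.
  assert (hm : RInt (fun t => g' t * g' t) 0 x <= sqnorm l g').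
  { unfold sqnorm, wip, unit_weight.
    rewrite <- (RInt_Chasles (V:=R_CompleteNormedModule) _ 0 x l) by (apply ex_RInt_cont; cont_tac).
    replace (RInt (fun t => g' t * g' t) 0 x) with
      (plus (RInt (fun x0 => 1 * g' x0 * g' x0) 0 x) 0).
    - apply Rplus_le_compat_l.
      replace 0 with (RInt (fun _ : R => 0) x l) at 1.
      + apply RInt_le; auto; try (apply ex_RInt_cont; cont_tac).
        intros t _. pose proof (Rle_0_sqr (g' t)). unfold Rsqr in *. lra.
      + rewrite RInt_const. unfold scal; simpl. unfold mult; simpl. ring.
    - unfold plus; simpl. rewrite Rplus_0_r. apply RInt_ext. intros t _.
      change (1 * g' t * g' t = g' t * g' t). ring. }
  destruct (Req_dec x 0) as [-> | hx0].
  { rewrite g0. replace (0^2) with 0 by ring. apply Rmult_le_pos; [lra|].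
    apply sqnorm_nonneg; auto; lra. }
  (* mu is the mean of g' over [0,x]. *)
  set (mu := g x / x).
  assert (hq : 0 <= wip x unit_weight (fun t => g' t + - mu * unit_weight t)
      (fun t => g' t + - mu * unit_weight t)).
  { apply sqnorm_nonneg; [lra|cont_tac]. }
  rewrite wip_square in hq by cont_tac.
  assert (E1 : wip x unit_weight g' unit_weight = g x).
  { transitivity (g x - g 0); [|rewrite g0; ring].
    rewrite <- (RInt_derivative g g' 0 x) by auto. apply RInt_ext. intros t _.
    unfold unit_weight. change (1 * g' t * 1 = g' t). ring. }
  assert (E2 : wip x unit_weight unit_weight unit_weight = x).
  { unfold wip, unit_weight. rewrite RInt_const. unfold scal; simpl. unfold mult; simpl. ring. }
  assert (E3 : wip x unit_weight g' g' = RInt (fun t => g' t * g' t) 0 x).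
  { apply RInt_ext. intros t _. change (1 * g' t * g' t = g' t * g' t). ring. }
  rewrite E1, E2, E3 in hq.
  assert (hmu : g x = mu * x) by (unfold mu; field; exact hx0).
  assert (hx' : 0 < x) by lra.
  assert (mu * g x <= sqnorm l g') by nra.
  assert (0 <= sqnorm l g') by (apply sqnorm_nonneg; auto; lra).
  apply Rle_trans with (x * sqnorm l g'); [|nra].
  rewrite hmu. rewrite hmu in H. nra.
Qed.

(** * Legendre polynomials *)

(** The identity P_(k+1)' = x P_k' + (k+1) P_k, taken as the definition of the
    derivative; [legendre_structure] shows that it is the derivative. *)
Fixpoint dlegendre (m : nat) (x : R) : R :=
  match m with
  | O => 0
  | S k => x * dlegendre k x + INR (S k) * legendre k x
  end.

Lemma legendre_SS j x :
  legendre (S (S j)) x =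
  ((2 * INR (S j) + 1) * x * legendre (S j) x - INR (S j) * legendre j x)
  / INR (S (S j)).
Proof. reflexivity. Qed.

Lemma dlegendre_S j x :
  dlegendre (S j) x = x * dlegendre j x + INR (S j) * legendre j x.
Proof. reflexivity. Qed.

Lemma bonnet j x :
  INR (S (S j)) * legendre (S (S j)) x =
  (2 * INR (S j) + 1) * x * legendre (S j) x - INR (S j) * legendre j x.
Proof. rewrite legendre_SS. field. apply not_0_INR. lia. Qed.

(** Bonnet's recurrence has two terms, so consecutive derivatives are treated
    together.  The third identity, x P_(n+1)' - P_n' = (n+1) P_(n+1), has to be
    carried along: it is what turns the differentiated recurrence into the
    recurrence defining [dlegendre]. *)
Lemma legendre_structure n :
  (forall x, is_derive (legendre n) x (dlegendre n x)) /\
  (forall x, is_derive (legendre (S n)) x (dlegendre (S n) x)) /\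
  (forall x, x * dlegendre (S n) x - dlegendre n x = INR (S n) * legendre (S n) x).
Proof.
  induction n as [|n (IH0 & IH1 & IH2)].
  - split; [|split]; intro x.
    + apply @is_derive_const.
    + simpl. evar_last; [apply @is_derive_id|]. unfold Hierarchy.one; simpl. ring.
    + simpl. ring.
  - split; [exact IH1|].
    assert (hB : forall x, x * dlegendre (S (S n)) x - dlegendre (S n) x
                 = INR (S (S n)) * legendre (S (S n)) x).
    { intro x. rewrite bonnet, (dlegendre_S (S n)), !S_INR.
      specialize (IH2 x). rewrite S_INR in IH2.
      assert (E : dlegendre (S n) x = x * (x * dlegendre (S n) x - (INR n + 1) * legendre (S n) x)
                  + (INR n + 1) * legendre n x).
      { rewrite <- IH2. rewrite dlegendre_S, S_INR. ring. }
      set (D := dlegendre (S n) x) in *. lra. }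
    split; [|exact hB].
    intro x.
    apply is_derive_ext with (fun x => / INR (S (S n)) *
      ((2 * INR (S n) + 1) * x * legendre (S n) x - INR (S n) * legendre n x)).
    { intro t. rewrite legendre_SS. apply Rmult_comm. }
    evar_last.
    { apply is_derive_Rscal, is_derive_Rminus.
      - apply (is_derive_Rmult (fun x => (2 * INR (S n) + 1) * x)).
        + apply is_derive_Rscal, @is_derive_id.
        + apply IH1.
      - apply is_derive_Rscal, IH0. }
    change (@Hierarchy.one R_AbsRing) with 1.
    apply (Rmult_eq_reg_l (INR (S (S n)))); [|apply not_0_INR; lia].
    rewrite <- Rmult_assoc, Rinv_r, Rmult_1_l by (apply not_0_INR; lia).
    rewrite (dlegendre_S (S n)).
    specialize (IH2 x).
    replace (dlegendre n x) with (x * dlegendre (S n) x - INR (S n) * legendre (S n) x)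
      by (rewrite <- IH2; ring).
    rewrite (S_INR (S n)). ring.
Qed.

Lemma is_derive_legendre n x : is_derive (legendre n) x (dlegendre n x).
Proof. apply legendre_structure. Qed.

(** A primitive of P_(n+1) is a combination of its two neighbours, which is why
    primitives raise the degree by only one in the Legendre basis. *)
Lemma legendre_primitive n x :
  dlegendre (S (S n)) x - dlegendre n x = (2 * INR (S n) + 1) * legendre (S n) x.
Proof.
  destruct (legendre_structure n) as (_ & _ & H). specialize (H x).
  rewrite dlegendre_S.
  replace (dlegendre n x) with (x * dlegendre (S n) x - INR (S n) * legendre (S n) x)
      by (rewrite <- H; ring).
  rewrite (S_INR (S n)). ring.
Qed.

Lemma weighted_dlegendre n x :
  (1 - x ^ 2) * dlegendre (S n) x = INR (S n) * (legendre n x - x * legendre (S n) x).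
Proof.
  destruct (legendre_structure n) as (_ & _ & H). specialize (H x).
  assert (E : x * (x * dlegendre (S n) x - dlegendre n x)
              = x * (INR (S n) * legendre (S n) x)) by (rewrite H; ring).
  assert (E' := dlegendre_S n x).
  replace ((1 - x ^ 2) * dlegendre (S n) x) with
    (dlegendre (S n) x - x * dlegendre n x
      - x * (x * dlegendre (S n) x - dlegendre n x)) by ring.
  rewrite E, E'. ring.
Qed.

(** Legendre's differential equation in Sturm-Liouville form: differentiate
    (1-y^2) P_n' = n (P_(n-1) - y P_n). *)
Lemma legendre_ode n x :
  is_derive (fun y => (1 - y ^ 2) * dlegendre n y) x
    (- (INR n * (INR n + 1)) * legendre n x).
Proof.
  destruct n as [|n].
  - apply is_derive_ext with (fun _ => 0); [intro t; simpl; ring|].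
    replace (- (INR 0 * (INR 0 + 1)) * legendre 0 x) with 0 by (simpl; ring).
    apply @is_derive_const.
  - apply is_derive_ext with
      (fun y => INR (S n) * (legendre n y - y * legendre (S n) y)).
    { intro t. symmetry. apply weighted_dlegendre. }
    evar_last.
    { apply is_derive_Rscal, is_derive_Rminus; [apply is_derive_legendre|].
      apply (is_derive_Rmult (fun y => y)); [apply @is_derive_id | apply is_derive_legendre]. }
    change (@Hierarchy.one R_AbsRing) with 1.
    destruct (legendre_structure n) as (_ & _ & H). specialize (H x).
    replace (dlegendre n x) with (x * dlegendre (S n) x - INR (S n) * legendre (S n) x)
      by (rewrite <- H; ring).
    ring.
Qed.

Definition dlegendre_shift (l : R) (m : nat) (x : R) : R := 2 / l * dlegendre m (2 * x / l - 1).

Lemma is_derive_to_shift l x : is_derive (fun y => 2 * y / l - 1) x (2 / l).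
Proof.
  apply is_derive_ext with (fun y => 2 / l * y + (-1)); [intro t; simpl; unfold Rdiv; ring|].
  evar_last.
  { apply is_derive_Rplus; [apply is_derive_Rscal, @is_derive_id | apply @is_derive_const]. }
  change (2 / l * 1 + 0 = 2 / l). ring.
Qed.

Lemma is_derive_shift l m x : is_derive (legendre_shift l m) x (dlegendre_shift l m x).
Proof.
  apply (is_derive_comp (legendre m) (fun y => 2 * y / l - 1)).
  - apply is_derive_legendre.
  - apply is_derive_to_shift.
Qed.

Lemma cont_legendre m : cont (legendre m).
Proof. apply (cont_derivable _ _ (is_derive_legendre m)). Qed.

Lemma cont_shift l m : cont (legendre_shift l m).
Proof. apply (cont_derivable _ _ (is_derive_shift l m)). Qed.
#[export] Hint Resolve cont_legendre cont_shift : cont.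

Lemma cont_dlegendre_shift l m : cont (dlegendre_shift l m).
Proof.
  assert (H : cont (dlegendre m)).
  { induction m as [|m IH]; [apply cont_const|].
    apply (cont_plus (fun x => x * dlegendre m x)); cont_tac. }
  apply cont_mult; [cont_tac|]. intro x.
  apply (continuous_comp (fun y => 2 * y / l - 1) (dlegendre m)); [|apply H].
  apply (cont_derivable _ _ (is_derive_to_shift l)).
Qed.
#[export] Hint Resolve cont_dlegendre_shift : cont.

(** Sturm-Liouville weight of the shifted Legendre polynomials; its zeros at both
    endpoints remove the boundary terms in integrations by parts. *)
Definition bubble (l x : R) : R := x * (l - x).

Lemma cont_bubble l : cont (bubble l).
Proof. change (cont (fun x => x * (l - x))). cont_tac. Qed.
#[export] Hint Resolve cont_bubble : cont.

Lemma shift_ode l m x : 0 < l ->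
  is_derive (fun y => bubble l y * dlegendre_shift l m y) x
    (- (INR m * (INR m + 1)) * legendre_shift l m x).
Proof.
  intro hl.
  apply is_derive_ext with (fun y => l / 2 *
    ((fun z => (1 - z ^ 2) * dlegendre m z) (2 * y / l - 1))).
  { intro t. unfold bubble, dlegendre_shift. cbv beta.
    set (D := dlegendre m _).
    change (l / 2 * ((1 - (2 * t / l - 1) ^ 2) * D) = t * (l - t) * (2 / l * D)).
    field. lra. }
  evar_last.
  { apply is_derive_Rscal.
    apply (is_derive_comp (fun z => (1 - z ^ 2) * dlegendre m z) (fun y => 2 * y / l - 1)).
    - apply legendre_ode.
    - apply is_derive_to_shift. }
  unfold scal; simpl; unfold mult; simpl. unfold legendre_shift.
  set (P := legendre m _). field. lra.
Qed.

(** * Orthogonality of the Legendre polynomials and of their derivatives *)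

Definition eigenvalue (m : nat) : R := INR m * (INR m + 1).

(** Weak form of the eigenvalue equation.  It transfers Legendre coefficients of u
    to weighted coefficients of u'. *)
Lemma shift_eigen l m (u u' : R -> R) : 0 < l -> (forall x, is_derive u x (u' x)) -> cont u' ->
  eigenvalue m * wip l unit_weight (legendre_shift l m) u
      = wip l (bubble l) (dlegendre_shift l m) u'.
Proof.
  intros hl hu cu'. assert (cu := cont_derivable _ _ hu).
  transitivity (- wip l unit_weight (fun y => - eigenvalue m * legendre_shift l m y) u).
  { rewrite wip_scal_l by cont_tac. ring. }
  rewrite (wip_by_parts l (fun y => bubble l y * dlegendre_shift l m y)
      (fun y => - eigenvalue m * legendre_shift l m y) u u'
            (fun x => shift_ode l m x hl) hu); try cont_tac; try (unfold bubble; ring).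
  rewrite Ropp_involutive. apply RInt_ext. intros x _. unfold unit_weight.
  change (1 * (bubble l x * dlegendre_shift l m x) * u' x
      = bubble l x * dlegendre_shift l m x * u' x). ring.
Qed.

(** The weak eigenvalue equation is symmetric in j and k, and the eigenvalues are
    distinct. *)
Lemma shift_orthogonal l j k : 0 < l -> j <> k ->
  wip l unit_weight (legendre_shift l j) (legendre_shift l k) = 0.
Proof.
  intros hl hjk.
  assert (E1 := shift_eigen l j _ _ hl (is_derive_shift l k) (cont_dlegendre_shift l k)).
  assert (E2 := shift_eigen l k _ _ hl (is_derive_shift l j) (cont_dlegendre_shift l j)).
  rewrite (wip_sym l (bubble l)) in E2. rewrite <- E1, (wip_sym l unit_weight) in E2.
  set (W := wip l unit_weight (legendre_shift l j) (legendre_shift l k)) in *.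
  assert (E : (INR j - INR k) * (INR j + INR k + 1) * W = 0) by (unfold eigenvalue in E2; lra).
  assert (hj := pos_INR j). assert (hk := pos_INR k).
  assert (INR j <> INR k) by (intro H; apply hjk; now apply INR_eq).
  apply Rmult_integral in E. destruct E as [E|E]; [exfalso|exact E].
  apply Rmult_integral in E. destruct E; lra.
Qed.

Lemma shift_recurrence l k x :
  INR (S (S k)) * legendre_shift l (S (S k)) x =
  (2 * INR (S k) + 1) * ((2 * x / l - 1) * legendre_shift l (S k) x)
  - INR (S k) * legendre_shift l k x.
Proof. unfold legendre_shift. rewrite bonnet. ring. Qed.

(** Used as a signed weight: multiplication by the variable of [-1,1]. *)
Definition to_shift (l x : R) : R := 2 * x / l - 1.

Lemma cont_to_shift l : cont (to_shift l).
Proof. apply (cont_derivable _ _ (is_derive_to_shift l)). Qed.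
#[export] Hint Resolve cont_to_shift : cont.

Lemma wip_to_shift l k g : 0 < l -> cont g ->
  (2 * INR (S k) + 1) * wip l (to_shift l) (legendre_shift l (S k)) g
  = INR (S (S k)) * wip l unit_weight (legendre_shift l (S (S k))) g
    + INR (S k) * wip l unit_weight (legendre_shift l k) g.
Proof.
  intros hl cg. unfold wip.
  rewrite <- !(Rmult_comm (RInt _ 0 l)).
  transitivity (RInt (fun x => 0 + INR (S (S k)) * (unit_weight x * legendre_shift l (S
      (S k)) x * g x)) 0 l
     + INR (S k) * RInt (fun x => unit_weight x * legendre_shift l k x * g x) 0 l).
  - rewrite <- RInt_lin by cont_tac.
    transitivity (RInt (fun x => 0) 0 l + (2 * INR (S k) + 1) *
       RInt (fun x => to_shift l x * legendre_shift l (S k) x * g x) 0 l).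
    { rewrite RInt_const. unfold scal; simpl; unfold mult; simpl. ring. }
    rewrite <- RInt_lin by cont_tac.
    apply RInt_ext. intros x _.
    assert (E := shift_recurrence l k x). unfold unit_weight, to_shift.
    set (a := legendre_shift l (S (S k)) x) in *.
    set (b := legendre_shift l (S k) x) in *.
    set (c := legendre_shift l k x) in *.
    change (0 + (2 * INR (S k) + 1) * ((2 * x / l - 1) * b * g x) =
      0 + INR (S (S k)) * (1 * a * g x) + INR (S k) * (1 * c * g x)).
    replace (0 + INR (S (S k)) * (1 * a * g x)) with (INR (S (S k)) * a * g x) by ring.
    rewrite E. ring.
  - rewrite RInt_lin by cont_tac. rewrite RInt_const.
    unfold scal; simpl; unfold mult; simpl. ring.
Qed.

(** Evaluating <t P_(m+1), P_m> by Bonnet's recurrence for either factor relates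
    the norms of P_m and P_(m+1). *)
Lemma shift_sqnorm l m : 0 < l -> (2 * INR m + 1) * sqnorm l (legendre_shift l m) = l.
Proof.
  intro hl. induction m as [|m IH].
  - unfold sqnorm, wip. rewrite (RInt_ext _ (fun _ => 1)).
    + rewrite RInt_const. unfold scal; simpl; unfold mult; simpl. ring.
    + intros x _. unfold unit_weight, legendre_shift. simpl. ring.
  - assert (E1 : (2 * INR (S m) + 1) * wip l (to_shift l) (legendre_shift l (S m))
      (legendre_shift l m)
      = INR (S m) * sqnorm l (legendre_shift l m)).
    { rewrite wip_to_shift by cont_tac. rewrite (shift_orthogonal l (S (S m)) m) by (lra || lia).
      unfold sqnorm. ring. }
    (* Bonnet's recurrence applied to P_m; for m = 0 it reads P_1 = t P_0. *)
    assert (E2 : INR (S m) * sqnorm l (legendre_shift l (S m)) =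
       (2 * INR m + 1) * wip l (to_shift l) (legendre_shift l (S m)) (legendre_shift l m)).
    { rewrite wip_sym. destruct m as [|m].
      - replace (sqnorm l (legendre_shift l 1)) with
          (wip l (to_shift l) (legendre_shift l 0) (legendre_shift l 1)); [simpl; ring|].
        apply RInt_ext. intros x _. unfold unit_weight, to_shift, legendre_shift. simpl. ring.
      - rewrite wip_to_shift by cont_tac. rewrite (shift_orthogonal l m (S (S m))) by (lra || lia).
        unfold sqnorm. ring. }
    assert (h := pos_INR m). rewrite S_INR in *.
    set (h1 := sqnorm l (legendre_shift l (S m))) in *.
    set (h0 := sqnorm l (legendre_shift l m)) in *.
    set (z := wip l (to_shift l) _ _) in *.
    apply (Rmult_eq_reg_l (INR m + 1)); [|lra].
    transitivity ((2 * (INR m + 1) + 1) * ((INR m + 1) * h1)); [ring|].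
    rewrite E2.
    transitivity ((2 * INR m + 1) * ((2 * (INR m + 1) + 1) * z)); [ring|].
    rewrite E1. rewrite <- IH. ring.
Qed.

Definition hat_scale (l : R) (m : nat) : R := 1 / (A_ m * sqrt l).

Lemma hat_scale_sq l m : 0 < l -> hat_scale l m ^ 2 = (2 * INR m + 1) / l.
Proof.
  intro hl. assert (h := pos_INR m). unfold hat_scale, A_.
  assert (0 < sqrt l) by (apply sqrt_lt_R0; lra).
  assert (0 < sqrt (2 * INR m + 1)) by (apply sqrt_lt_R0; lra).
  replace ((1 / (1 / sqrt (2 * INR m + 1) * sqrt l)) ^ 2) with
    ((sqrt (2 * INR m + 1) * sqrt (2 * INR m + 1)) / (sqrt l * sqrt l)) by (field; lra).
  rewrite !sqrt_sqrt by lra. reflexivity.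
Qed.

Definition dlegendre_hat (l : R) (m : nat) (x : R) : R := hat_scale l m * dlegendre_shift l m x.

Lemma is_derive_hat l m x : is_derive (legendre_hat l m) x (dlegendre_hat l m x).
Proof. apply is_derive_Rscal, is_derive_shift. Qed.

Lemma cont_hat l m : cont (legendre_hat l m).
Proof. apply (cont_derivable _ _ (is_derive_hat l m)). Qed.

Lemma cont_dlegendre_hat l m : cont (dlegendre_hat l m).
Proof. apply (cont_mult (fun _ => hat_scale l m)); cont_tac. Qed.
#[export] Hint Resolve cont_hat cont_dlegendre_hat : cont.

Lemma wip_hat l m u : cont u ->
  wip l unit_weight (legendre_hat l m) u
  = hat_scale l m * wip l unit_weight (legendre_shift l m) u.
Proof. intro cu. apply (wip_scal_l l unit_weight (hat_scale l m)); cont_tac. Qed.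

Lemma hat_orthonormal l j k : 0 < l ->
  wip l unit_weight (legendre_hat l j) (legendre_hat l k) = if Nat.eq_dec j k then 1 else 0.
Proof.
  intro hl.
  transitivity (hat_scale l j * (hat_scale l k * wip l unit_weight (legendre_shift l j)
      (legendre_shift l k))).
  - rewrite wip_hat by cont_tac. f_equal. rewrite wip_sym, wip_hat
      by cont_tac. f_equal. apply wip_sym.
  - destruct (Nat.eq_dec j k) as [<-|hjk].
    + rewrite <- Rmult_assoc. replace (hat_scale l j * hat_scale l j) with (hat_scale l j ^ 2)
        by ring.
      rewrite hat_scale_sq by exact hl.
      transitivity ((2 * INR j + 1) * sqnorm l (legendre_shift l j) / l);
          [|rewrite shift_sqnorm by exact hl; field; lra].
      unfold sqnorm; field; lra.
    + rewrite shift_orthogonal by auto. ring.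
Qed.

Lemma hat_eigen l m (u u' : R -> R) : 0 < l -> (forall x, is_derive u x (u' x)) -> cont u' ->
  eigenvalue m * wip l unit_weight (legendre_hat l m) u = wip l (bubble l) (dlegendre_hat l m) u'.
Proof.
  intros hl hu cu'. assert (cu := cont_derivable _ _ hu).
  rewrite wip_hat by cont_tac.
  transitivity (hat_scale l m * (eigenvalue m * wip l unit_weight (legendre_shift l m) u)); [ring|].
  rewrite (shift_eigen l m u u') by auto.
  symmetry. apply (wip_scal_l l (bubble l) (hat_scale l m)); cont_tac.
Qed.

(** Orthogonality of the derivatives follows from that of the polynomials through
    [hat_eigen] with u = legendre_hat l k. *)
Lemma hat_deriv_orthogonal l j k : 0 < l ->
  wip l (bubble l) (dlegendre_hat l j) (dlegendre_hat l k)
      = if Nat.eq_dec j k then eigenvalue j else 0.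
Proof.
  intro hl. rewrite <- (hat_eigen l j (legendre_hat l k)); auto using is_derive_hat with cont.
  rewrite hat_orthonormal by exact hl. destruct (Nat.eq_dec j k); ring.
Qed.

(** * Orthogonal expansions *)

(** u minus the first n terms of its expansion, the terms of index below n.  The
    recursive form lets its norm be expanded one term at a time. *)
Fixpoint residual (c : nat -> R) (e : nat -> R -> R) (u : R -> R) (n : nat) (x : R) : R :=
  match n with
  | O => u x
  | S k => residual c e u k x + (- c k) * e k x
  end.

Lemma cont_residual c e u n : (forall m, cont (e m)) -> cont u -> cont (residual c e u n).
Proof.
  intros he hu. induction n as [|n IH]; [exact hu|].
  apply (cont_plus (residual c e u n)); cont_tac.
Qed.

Lemma residual_coef l rho (e : nat -> R -> R) (w c : nat -> R) u
  (crho : cont rho) (ce : forall m, cont (e m)) (cu : cont u)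
  (he : forall j k, wip l rho (e j) (e k) = if Nat.eq_dec j k then w j else 0)
  (hc : forall m, wip l rho u (e m) = w m * c m) n k :
  wip l rho (residual c e u n) (e k) = if le_lt_dec n k then w k * c k else 0.
Proof.
  assert (H := fun m => cont_residual c e u m ce cu).
  induction n as [|n IH].
  - destruct (le_lt_dec 0 k); [apply hc | lia].
  - change (residual c e u (S n)) with (fun x => residual c e u n x + (- c n) * e n x).
    rewrite wip_lin_l by cont_tac. rewrite IH, he.
    destruct (Nat.eq_dec n k) as [E|E]; [subst k|];
      destruct (le_lt_dec n _), (le_lt_dec (S n) _); try lia; ring.
Qed.

(** Both Bessel inequalities, for u and for u', are this identity; c m is a
    coefficient relative to an orthogonal family with squared norms w m. *)
Lemma residual_pythagoras l rho (e : nat -> R -> R) (w c : nat -> R) u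
  (crho : cont rho) (ce : forall m, cont (e m)) (cu : cont u)
  (he : forall j k, wip l rho (e j) (e k) = if Nat.eq_dec j k then w j else 0)
  (hc : forall m, wip l rho u (e m) = w m * c m) n :
  wip l rho (residual c e u (S n)) (residual c e u (S n))
  = wip l rho (residual c e u n) (residual c e u n) - w n * c n ^ 2.
Proof.
  assert (H := fun m => cont_residual c e u m ce cu).
  change (residual c e u (S n)) with (fun x => residual c e u n x + (- c n) * e n x).
  rewrite wip_square by auto. rewrite (residual_coef l rho e w c u), he by assumption.
  destruct (le_lt_dec n n), (Nat.eq_dec n n); try lia; ring.
Qed.

(** * Polynomials and best approximation *)

(** Polynomials of degree less than n, written in the Legendre basis so that
    orthogonality to them is immediate. *)
Fixpoint in_span (l : R) (n : nat) (q : R -> R) : Prop :=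
  match n with
  | O => forall x, q x = 0
  | S k => exists c r, in_span l k r /\ forall x, q x = r x + c * legendre_shift l k x
  end.

Lemma in_span_ext l n q r : (forall x, q x = r x) -> in_span l n q -> in_span l n r.
Proof.
  destruct n as [|n]; simpl; intro E.
  - intros h x. rewrite <- E. apply h.
  - intros (c & s & hs & h). exists c, s. split; [exact hs|]. intro x. rewrite <- E. apply h.
Qed.

Lemma in_span_lin l n q c r : in_span l n q -> in_span l n r ->
  in_span l n (fun x => q x + c * r x).
Proof.
  revert q r. induction n as [|n IH]; simpl; intros q r.
  - intros hq hr x. rewrite hq, hr. ring.
  - intros (a & q1 & hq1 & hq) (b & r1 & hr1 & hr).
    exists (a + c * b), (fun x => q1 x + c * r1 x). split; [now apply IH|].
    intro x. rewrite hq, hr. ring.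
Qed.

Lemma in_span_zero l n : in_span l n (fun _ => 0).
Proof.
  induction n as [|n IH]; simpl; [reflexivity|].
  exists 0, (fun _ => 0). split; [exact IH|]. intro; ring.
Qed.

Lemma in_span_S l n q : in_span l n q -> in_span l (S n) q.
Proof. intro h. exists 0, q. split; [exact h|]. intro; ring. Qed.

Lemma in_span_shift l n k : (k < n)%nat -> in_span l n (legendre_shift l k).
Proof.
  induction 1 as [|n hn IH].
  - exists 1, (fun _ => 0). split; [apply in_span_zero|]. intro; ring.
  - now apply in_span_S.
Qed.

Lemma in_span_scal l n c q : in_span l n q -> in_span l n (fun x => c * q x).
Proof.
  intro h. apply (in_span_ext l n (fun x => 0 + c * q x)); [intro; ring|].
  apply in_span_lin; [apply in_span_zero | exact h].
Qed.

(** By Bonnet's recurrence; this is what places arbitrary polynomials, such as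
    Bernstein's, in the span of Legendre polynomials. *)
Lemma in_span_mul_id l n q : 0 < l -> in_span l n q -> in_span l (S n) (fun x => x * q x).
Proof.
  intro hl. revert q. induction n as [|n IH]; intros q.
  - intro h. apply (in_span_ext l 1 (fun _ => 0)).
    + intro x. rewrite h. ring.
    + apply in_span_zero.
  - intros (c & r & hr & h).
    apply (in_span_ext l _ (fun x => x * r x + c * (x * legendre_shift l n x))).
    { intro x. rewrite h. ring. }
    apply in_span_lin; [now apply in_span_S, IH|].
    destruct n as [|k].
    + apply (in_span_ext l 2 (fun x => l / 2 * legendre_shift l 1 x + l / 2 * legendre_shift l 0
        x)).
      { intro x. unfold legendre_shift. simpl. field. lra. }
      apply in_span_lin; [apply in_span_scal|]; apply in_span_shift; lia.
    + assert (hk := pos_INR (S k)).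
      apply (in_span_ext l _ (fun x => l / 2 * (legendre_shift l (S k) x
         + / (2 * INR (S k) + 1) * (INR (S (S k)) * legendre_shift l (S (S k)) x
            + INR (S k) * legendre_shift l k x)))).
      { intro x. rewrite shift_recurrence. field. split; lra. }
      apply in_span_scal, in_span_lin; [apply in_span_shift; lia|].
      apply in_span_lin; [apply in_span_scal|]; apply in_span_shift; lia.
Qed.

Lemma in_span_primitive l n q : 0 < l -> in_span l n q ->
  exists r, in_span l (S n) r /\ forall x, is_derive r x (q x).
Proof.
  intro hl. revert q. induction n as [|n IH]; intros q.
  - intro h. exists (fun _ => 0). split; [apply in_span_zero|].
    intro x. rewrite h. apply @is_derive_const.
  - intros (c & r & hr & h). destruct (IH r hr) as (s & hs & hs').
    enough (exists p, in_span l (S (S n)) p /\ forall x, is_derive p x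
        (legendre_shift l n x)) as (p & hp & hp').
    { exists (fun x => s x + c * p x). split.
      - apply in_span_lin; [now apply in_span_S | exact hp].
      - intro x. rewrite h. apply is_derive_Rplus; [apply hs'|]. apply is_derive_Rscal, hp'. }
    destruct n as [|k].
    + exists (fun x => l / 2 * legendre_shift l 1 x). split.
      * apply in_span_scal, in_span_shift; lia.
      * intro x. evar_last; [apply is_derive_Rscal, is_derive_shift|].
        unfold dlegendre_shift, legendre_shift. simpl. field. lra.
    + assert (hk := pos_INR (S k)).
      exists (fun x => l / 2 / (2 * INR (S k) + 1) * (legendre_shift l (S (S k)) x
        + -1 * legendre_shift l k x)). split.
      * apply in_span_scal, in_span_lin; apply in_span_shift; lia.
      * intro x. evar_last.
        { apply is_derive_Rscal, is_derive_Rplus; [|apply is_derive_Rscal]; apply is_derive_shift. }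
        unfold dlegendre_shift, legendre_shift.
        transitivity (/ (2 * INR (S k) + 1) * (dlegendre (S (S k)) (2 * x / l - 1) - dlegendre k
            (2 * x / l - 1))).
        { field. split; lra. }
        rewrite legendre_primitive. field. lra.
Qed.

Lemma in_span_cont l n q : in_span l n q -> cont q.
Proof.
  revert q. induction n as [|n IH]; intros q hq.
  - apply (cont_ext (fun _ => 0)); [intro; symmetry; apply hq | cont_tac].
  - destruct hq as (c & r & hr & h). apply IH in hr.
    apply (cont_ext (fun x => r x + c * legendre_shift l n x));
        [intro; symmetry; apply h | cont_tac].
Qed.

Lemma in_span_orthogonal l n g q : 0 < l -> cont g -> in_span l n q ->
  (forall k, (k < n)%nat -> wip l unit_weight g (legendre_shift l k) = 0) ->
  wip l unit_weight g q = 0.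
Proof.
  intros hl cg. revert q. induction n as [|n IH]; intros q hq hg.
  - rewrite (wip_ext l unit_weight g q g (fun x => 0 * unit_weight x));
      [|lra|reflexivity|intros; rewrite hq; ring].
    rewrite wip_scal_r by cont_tac. ring.
  - destruct hq as (c & r & hr & h). assert (cr := in_span_cont _ _ _ hr).
    rewrite (wip_ext l unit_weight g q g (fun x => r x + c * legendre_shift l n x));
      [|lra|reflexivity|intros; apply h].
    rewrite wip_lin_r by cont_tac. rewrite hg by lia. rewrite IH; auto. ring.
Qed.

Definition coef (l : R) (u : R -> R) (m : nat) : R := wip l unit_weight (legendre_hat l m) u.

Definition remainder (l : R) (u : R -> R) (n : nat) : R -> R :=
  residual (coef l u) (legendre_hat l) u n.

Lemma cont_remainder l u n : cont u -> cont (remainder l u n).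
Proof. intro. apply cont_residual; auto with cont. Qed.
#[export] Hint Resolve cont_remainder : cont.

Lemma remainder_span l u n : in_span l n (fun x => u x - remainder l u n x).
Proof.
  induction n as [|n IH].
  - intro x. unfold remainder; simpl. ring.
  - exists (coef l u n * hat_scale l n), (fun x => u x - remainder l u n x).
    split; [exact IH|]. intro x. unfold remainder, legendre_hat; simpl. unfold hat_scale. ring.
Qed.

Lemma remainder_orthogonal l u n k : 0 < l -> cont u -> (k < n)%nat ->
  wip l unit_weight (remainder l u n) (legendre_hat l k) = 0.
Proof.
  intros hl cu hk.
  unfold remainder. rewrite (residual_coef l unit_weight (legendre_hat l)
      (fun _ => 1)); auto with cont.
  - destruct (le_lt_dec n k); [lia | reflexivity].
  - intros; apply hat_orthonormal; exact hl.
  - intro m. rewrite wip_sym. unfold coef. ring.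
Qed.

Lemma hat_scale_neq0 l m : 0 < l -> hat_scale l m <> 0.
Proof.
  intros hl E. assert (H := hat_scale_sq l m hl). rewrite E in H. assert (h := pos_INR m).
  assert (0 < (2 * INR m + 1) / l) by (apply Rdiv_lt_0_compat; lra).
  lra.
Qed.

(** The remainder is orthogonal to the polynomials of degree less than n, so
    u - q is its orthogonal sum with such a polynomial. *)
Lemma remainder_best l u n q : 0 < l -> cont u -> in_span l n q ->
  sqnorm l (remainder l u n) <= sqnorm l (fun x => u x - q x).
Proof.
  intros hl cu hq.
  set (s := fun x => (u x - remainder l u n x) + -1 * q x).
  assert (hs : in_span l n s) by (apply in_span_lin; [apply remainder_span | exact hq]).
  assert (cs := in_span_cont _ _ _ hs).
  assert (E : wip l unit_weight (remainder l u n) s = 0).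
  { apply (in_span_orthogonal l n); try cont_tac; auto.
    intros k hk. apply (Rmult_eq_reg_l (hat_scale l k)); [|apply hat_scale_neq0; exact hl].
    rewrite Rmult_0_r, wip_sym, <- wip_hat, wip_sym by cont_tac. now apply remainder_orthogonal. }
  unfold sqnorm at 2.
  rewrite (wip_ext l unit_weight _ _ (fun x => remainder l u n x + 1 * s x)
      (fun x => remainder l u n x + 1 * s x));
    [|lra|intros; unfold s; ring|intros; unfold s; ring].
  rewrite wip_square by cont_tac. rewrite E.
  assert (h := sqnorm_nonneg l s ltac:(lra) cs). unfold sqnorm in *. lra.
Qed.

(** * Bernstein polynomials and completeness *)

(** The Bernstein operator as an expectation: the mean of g at the number of
    successes among n independent trials of probability t.  Conditioning on one
    trial replaces the binomial coefficients, and all properties follow by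
    induction on n. *)
Fixpoint bernstein (n : nat) (g : nat -> R) (t : R) : R :=
  match n with
  | O => g O
  | S k => (1 - t) * bernstein k g t + t * bernstein k (fun j => g (S j)) t
  end.

Lemma bernstein_le n g h t : 0 <= t <= 1 ->
  (forall k, (k <= n)%nat -> g k <= h k) -> bernstein n g t <= bernstein n h t.
Proof.
  intro ht. revert g h. induction n as [|n IH]; simpl; intros g h H.
  - apply H; lia.
  - apply Rplus_le_compat; apply Rmult_le_compat_l; try lra; apply IH; intros; apply H; lia.
Qed.

Lemma bernstein_ext n g h t : (forall k, g k = h k) -> bernstein n g t = bernstein n h t.
Proof.
  revert g h. induction n as [|n IH]; simpl; intros g h H; [apply H|].
  rewrite (IH g h), (IH (fun j => g (S j)) (fun j => h (S j))); auto.
Qed.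

(** Variance n t (1-t) plus squared bias. *)
Lemma bernstein_variance n c s t :
  bernstein n (fun k => s * (INR k - c) ^ 2) t
  = s * (INR n * (t * (1 - t)) + (INR n * t - c) ^ 2).
Proof.
  revert c. induction n as [|n IH]; intro c.
  - simpl. ring.
  - transitivity ((1 - t) * bernstein n (fun k => s * (INR k - c) ^ 2) t
                  + t * bernstein n (fun k => s * (INR k - (c - 1)) ^ 2) t).
    + cbn [bernstein]. f_equal. f_equal.
      apply bernstein_ext. intro k. rewrite S_INR. ring.
    + rewrite !IH, S_INR. ring.
Qed.

Lemma bernstein_jensen n g v t : 0 <= t <= 1 ->
  (bernstein n g t - v) ^ 2 <= bernstein n (fun k => (g k - v) ^ 2) t.
Proof.
  intro ht. revert g. induction n as [|n IH]; simpl bernstein; intro g; [lra|].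
  assert (H1 := IH g). assert (H2 := IH (fun j => g (S j))). cbv beta in H2.
  set (a := bernstein n g t) in *. set (b := bernstein n (fun j => g (S j)) t) in *.
  set (A := bernstein n (fun k => (g k - v) ^ 2) t) in *.
  set (B := bernstein n (fun k => (g (S k) - v) ^ 2) t) in *.
  apply Rle_trans with ((1 - t) * (a - v) ^ 2 + t * (b - v) ^ 2).
  - assert (0 <= t * (1 - t) * (a - b) ^ 2).
    { apply Rmult_le_pos; [apply Rmult_le_pos; lra|]. apply pow2_ge_0. }
    lra.
  - apply Rplus_le_compat; apply Rmult_le_compat_l; try lra; [exact H1 | exact H2].
Qed.

Lemma in_span_bernstein l n g : 0 < l -> in_span l (S n) (fun x => bernstein n g (x / l)).
Proof.
  intro hl. revert g. induction n as [|n IH]; intro g.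
  - exists (g O), (fun _ => 0). split; [apply in_span_zero|].
    intro x. unfold legendre_shift. simpl. ring.
  - apply (in_span_ext l _ (fun x => bernstein n g (x / l) + / l *
      (x * (bernstein n (fun j => g (S j)) (x / l) + -1 * bernstein n g (x / l))))).
    { intro x. simpl. field. lra. }
    apply in_span_lin; [apply in_span_S, IH|].
    apply in_span_mul_id; [exact hl|]. apply in_span_lin; apply IH.
Qed.

Lemma bounded_derivative l (u u' : R -> R) : 0 < l ->
  (forall x, is_derive u x (u' x)) -> cont u' ->
  exists L, 0 <= L /\ forall x y, 0 <= x <= l -> 0 <= y <= l -> (u y - u x) ^ 2 <= L * (y - x) ^ 2.
Proof.
  intros hl hu cu'.
  destruct (continuity_ab_maj (fun x => u' x * u' x) 0 l) as (M & hM & _); [lra| |].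
  { intros x _. apply continuity_pt_filterlim. apply (cont_mult u' u' cu' cu'). }
  exists (u' M * u' M). split; [apply Rle_0_sqr|].
  intros x y hx hy.
  destruct (MVT_gen u x y u') as (c & hc & E).
  - intros; apply hu.
  - intros; apply continuity_pt_filterlim. apply (cont_derivable _ _ hu).
  - rewrite E. assert (0 <= c <= l).
    { unfold Rmin, Rmax in hc. destruct (Rle_dec x y); lra. }
    rewrite Rpow_mult_distr. apply Rmult_le_compat_r; [apply pow2_ge_0|].
    specialize (hM c H). cbv beta in hM. lra.
Qed.

(** Completeness of the Legendre polynomials, for C^1 functions: the Bernstein
    polynomial with nodes l k / n has pointwise squared error at most L l^2 / n, by
    Jensen's inequality and the variance formula. *)
Lemma remainder_vanishes l (u u' : R -> R) : 0 < l ->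
  (forall x, is_derive u x (u' x)) -> cont u' ->
  exists K, 0 <= K /\ forall n, (1 <= n)%nat -> sqnorm l (remainder l u (S n)) <= K / INR n.
Proof.
  intros hl hu cu'. assert (cu := cont_derivable _ _ hu).
  destruct (bounded_derivative l u u' hl hu cu') as (L & hL & HL).
  exists (L * l ^ 2 * l). split.
  { apply Rmult_le_pos; [apply Rmult_le_pos; [lra | apply pow2_ge_0] | lra]. }
  intros n hn.
  assert (hn' : 0 < INR n) by (apply lt_0_INR; lia).
  set (g := fun k => u (l * (INR k / INR n))).
  assert (hB := in_span_bernstein l n g hl).
  assert (cB := in_span_cont _ _ _ hB).
  eapply Rle_trans; [apply (remainder_best l u (S n) _ hl cu hB)|].
  set (B := fun x => bernstein n g (x / l)) in *.
  apply Rle_trans with (wip l unit_weight (fun _ => L * l ^ 2 / INR n) unit_weight).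
  - apply wip_le; try lra; try cont_tac.
    intros x hx. unfold unit_weight. rewrite Rmult_1_l, Rmult_1_r.
    assert (ht : 0 <= x / l <= 1).
    { split; [apply Rlt_le, Rdiv_lt_0_compat; lra|].
      apply (Rmult_le_reg_r l); [lra|]. unfold Rdiv. rewrite Rmult_assoc, Rinv_l by lra. lra. }
    apply Rle_trans with ((bernstein n g (x / l) - u x) ^ 2); [apply Req_le; ring|].
    eapply Rle_trans; [apply (bernstein_jensen n g (u x) (x / l) ht)|].
    apply Rle_trans with
      (bernstein n (fun k => L * l ^ 2 / INR n ^ 2 * (INR k - INR n * (x / l)) ^ 2) (x / l)).
    + apply bernstein_le; [exact ht|]. intros k hk. unfold g.
      assert (hk' : 0 <= INR k / INR n <= 1).
      { assert (hk0 := pos_INR k). apply le_INR in hk. split.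
        - unfold Rdiv. apply Rmult_le_pos; [lra | apply Rlt_le, Rinv_0_lt_compat; lra].
        - apply (Rmult_le_reg_r (INR n)); [lra|].
          unfold Rdiv. rewrite Rmult_assoc, Rinv_l by lra. lra. }
      eapply Rle_trans; [apply HL; [lra|nra]|].
      apply Req_le. field. lra.
    + rewrite bernstein_variance.
      replace ((INR n * (x / l) - INR n * (x / l)) ^ 2) with 0 by ring.
      set (t := x / l) in *.
      replace (L * l ^ 2 / INR n ^ 2 * (INR n * (t * (1 - t)) + 0)) with
        (L * l ^ 2 / INR n * (t * (1 - t))) by (field; lra).
      rewrite <- (Rmult_1_r (L * l ^ 2 / INR n)) at 2.
      apply Rmult_le_compat_l; [|nra].
      apply Rmult_le_pos; [apply Rmult_le_pos; [lra | apply pow2_ge_0]|].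
      apply Rlt_le, Rinv_0_lt_compat; lra.
  - apply Req_le. unfold wip, unit_weight. rewrite RInt_const.
    unfold scal; simpl; unfold mult; simpl. field. lra.
Qed.

(** * Rate of approximation by Legendre expansions *)

Lemma sqnorm_remainder_S l u n : 0 < l -> cont u ->
  sqnorm l (remainder l u (S n)) = sqnorm l (remainder l u n) - coef l u n ^ 2.
Proof.
  intros hl cu.
  assert (H := residual_pythagoras l unit_weight (legendre_hat l) (fun _ => 1) (coef l u) u).
  unfold sqnorm, remainder. rewrite H; auto with cont.
  - ring.
  - intros; apply hat_orthonormal; exact hl.
  - intro m. rewrite wip_sym. unfold coef. ring.
Qed.

(** Removing the term of index m lowers ||remainder||^2 by c_m^2, and lowers the
    squared weighted norm D of the residual of u' along the differentiated Legendre
    polynomials by m(m+1) c_m^2.  Between the indices n and n + j, the first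
    quantity times n(n+1) thus decreases by no more than D does, and D stays
    nonnegative; then j tends to infinity. *)
Lemma jackson l u (u' : R -> R) n : 0 < l ->
  (forall x, is_derive u x (u' x)) -> cont u' ->
  eigenvalue n * sqnorm l (remainder l u n) <= wip l (bubble l) u' u'.
Proof.
  intros hl hu cu'. assert (cu := cont_derivable _ _ hu).
  set (D := fun m => wip l (bubble l) (residual (coef l u) (dlegendre_hat l) u' m)
                                      (residual (coef l u) (dlegendre_hat l) u' m)).
  assert (hlam : forall m, 0 <= eigenvalue m).
  { intro m. assert (h := pos_INR m). unfold eigenvalue. nra. }
  assert (D_S : forall m, D (S m) = D m - eigenvalue m * coef l u m ^ 2).
  { intro m. unfold D. apply residual_pythagoras; try cont_tac.
    - intros; apply hat_deriv_orthogonal; exact hl.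
    - intro k. rewrite wip_sym, <- (hat_eigen l k u u') by auto. reflexivity. }
  assert (D_pos : forall m, 0 <= D m).
  { intro m. unfold D. apply wip_nonneg.
    - lra.
    - cont_tac.
    - apply cont_residual; auto with cont.
    - intros x hx. unfold bubble. apply Rmult_le_pos; lra. }
  assert (D_le : D n <= D O).
  { clear - D_S hlam. induction n as [|n IH]; [lra|]. rewrite D_S.
    assert (0 <= eigenvalue n * coef l u n ^ 2) by (apply Rmult_le_pos;
        [apply hlam | apply pow2_ge_0]).
    lra. }
  assert (tail : forall j,
    eigenvalue n * (sqnorm l (remainder l u n) - sqnorm l (remainder l u (n + j)))
    <= D n - D (n + j)%nat).
  { induction j as [|j IH].
    - rewrite Nat.add_0_r. lra.
    - rewrite Nat.add_succ_r, sqnorm_remainder_S, D_S by auto.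
      assert (eigenvalue n * coef l u (n + j) ^ 2 <= eigenvalue (n + j) * coef l u (n + j) ^ 2).
      { apply Rmult_le_compat_r; [apply pow2_ge_0|]. unfold eigenvalue.
        rewrite plus_INR. assert (h := pos_INR n). assert (h' := pos_INR j). nra. }
      lra. }
  destruct (remainder_vanishes l u u' hl hu cu') as (K & hK & HK).
  apply le_epsilon. intros eps heps.
  assert (hz : 0 < eps / (eigenvalue n * K + 1)).
  { apply Rdiv_lt_0_compat; [exact heps|]. assert (0 <= eigenvalue n * K)
      by (apply Rmult_le_pos; auto). lra. }
  destruct (archimed_cor1 _ hz) as (M & hM & hM0).
  assert (hlK : 0 <= eigenvalue n * K) by (apply Rmult_le_pos; auto).
  assert (hsm : eigenvalue n * (K / INR (n + M)) <= eps).
  { assert (h1 : 0 < INR M) by (apply lt_0_INR; lia).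
    assert (h2 : INR M <= INR (n + M)) by (apply le_INR; lia).
    apply Rle_trans with (eigenvalue n * K * / INR M).
    - unfold Rdiv. rewrite <- Rmult_assoc. apply Rmult_le_compat_l; [exact hlK|].
      apply Rinv_le_contravar; lra.
    - apply Rle_trans with ((eigenvalue n * K + 1) * (eps / (eigenvalue n * K + 1))).
      + apply Rmult_le_compat; try lra. apply Rlt_le, Rinv_0_lt_compat; lra.
      + apply Req_le. field. lra. }
  specialize (tail (S M)). rewrite Nat.add_succ_r in tail.
  assert (HK' := HK (n + M)%nat ltac:(lia)).
  assert (h3 := Rmult_le_compat_l _ _ _ (hlam n) HK').
  assert (h4 := D_pos (S (n + M))).
  change (wip l (bubble l) u' u') with (D O). lra.
Qed.

Fixpoint smooth (k : nat) (u : R -> R) : Prop :=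
  match k with
  | O => cont u
  | S j => exists u' : R -> R, (forall x, is_derive u x (u' x)) /\ smooth j u'
  end.

Lemma smooth_cont k u : smooth k u -> cont u.
Proof.
  destruct k; [auto|]. intros (u' & hu & _). exact (cont_derivable _ _ hu).
Qed.

Lemma remainder_le l u n : 0 < l -> cont u -> sqnorm l (remainder l u n) <= sqnorm l u.
Proof.
  intros hl cu. eapply Rle_trans; [apply (remainder_best l u n (fun _ => 0) hl cu), in_span_zero|].
  apply Req_le. apply wip_ext; [lra| |]; intros; ring.
Qed.

(** Subtracting from u a primitive Q of the projection of u' leaves a function
    whose derivative is the remainder of u'; Q itself is a polynomial of degree at
    most m, so approximating u - Q suffices. *)
Lemma remainder_improve l u (u' : R -> R) m : 0 < l ->
  (forall x, is_derive u x (u' x)) -> cont u' ->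
  eigenvalue (S m) * sqnorm l (remainder l u (S m)) <= l ^ 2 * sqnorm l (remainder l u' m).
Proof.
  intros hl hu cu'. assert (cu := cont_derivable _ _ hu).
  destruct (in_span_primitive l m _ hl (remainder_span l u' m)) as (Q & hQ & hQ').
  assert (cQ := in_span_cont _ _ _ hQ).
  set (v := fun x => u x + -1 * Q x).
  assert (hv : forall x, is_derive v x (remainder l u' m x)).
  { intro x. evar_last; [apply is_derive_Rplus; [apply hu | apply is_derive_Rscal, hQ']|].
    cbv beta. change (u' x + -1 * (u' x - remainder l u' m x) = remainder l u' m x). ring. }
  assert (cv := cont_derivable _ _ hv).
  apply Rle_trans with (eigenvalue (S m) * sqnorm l (remainder l v (S m))).
  - apply Rmult_le_compat_l.
    { assert (h := pos_INR (S m)). unfold eigenvalue. nra. }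
    eapply Rle_trans.
    + apply (remainder_best l u (S m) (fun x => Q x + 1 * (v x - remainder l v (S m) x)) hl cu).
      apply in_span_lin; [exact hQ | apply remainder_span].
    + apply Req_le. apply wip_ext; [lra| |]; intros; unfold v; ring.
  - eapply Rle_trans; [apply (jackson l v _ (S m) hl hv); cont_tac|].
    unfold sqnorm.
    rewrite <- wip_scal_l by cont_tac. apply wip_le; try lra; try cont_tac.
    intros x hx. unfold bubble.
    rewrite !Rmult_assoc, <- Rmult_assoc. apply Rmult_le_compat_r; [apply Rle_0_sqr | nra].
Qed.

(** Induction on k by [remainder_improve], which passes from index m to m + 1; the
    factor 4^k absorbs the ratio (m+1)^(2k) / m^(2k). *)
Lemma remainder_rate l k : 0 < l -> forall u, smooth k u ->
  exists C, 0 <= C /\ forall n, (1 <= n)%nat -> sqnorm l (remainder l u n) <= C / INR n ^ (2 * k).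
Proof.
  intro hl. induction k as [|k IH]; intros u hu.
  - exists (sqnorm l u). split; [apply sqnorm_nonneg; [lra | exact hu]|].
    intros n _. simpl. rewrite Rdiv_1_r. apply remainder_le; [exact hl | exact hu].
  - assert (cu := smooth_cont _ _ hu). destruct hu as (u' & hu & hu').
    assert (cu' := smooth_cont _ _ hu').
    destruct (IH u' hu') as (C & hC & H).
    assert (h0 : 0 <= sqnorm l u) by (apply sqnorm_nonneg; auto; lra).
    assert (h4 : 0 < 4 ^ k) by (apply pow_lt; lra).
    assert (h5 : 0 <= l ^ 2 * C * 4 ^ k) by (apply Rmult_le_pos; [apply Rmult_le_pos;
        [apply pow2_ge_0 | lra] | lra]).
    exists (sqnorm l u + l ^ 2 * C * 4 ^ k). split; [lra|].
    intros n hn. destruct n as [|[|m]]; [lia| |].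
    (* The induction step reaches only n at least 2; n = 1 is the trivial bound. *)
    + replace (INR 1 ^ (2 * S k)) with 1 by (simpl INR; rewrite pow1; reflexivity).
      rewrite Rdiv_1_r. assert (h := remainder_le l u 1 hl cu). lra.
    + set (r := S m) in *.
      assert (hr : 1 <= INR r) by (apply (le_INR 1); unfold r; lia).
      assert (h1 := remainder_improve l u u' r hl hu cu').
      assert (h2 := H r ltac:(unfold r; lia)).
      assert (h3 := Rmult_le_compat_l _ _ _ (pow2_ge_0 l) h2).
      set (S1 := sqnorm l (remainder l u (S r))) in *.
      assert (hS1 : 0 <= S1) by (apply sqnorm_nonneg; [lra | cont_tac]).
      rewrite S_INR. set (t := INR r) in *.
      assert (hlam : (t + 1) ^ 2 <= eigenvalue (S r)).
      { unfold eigenvalue. rewrite S_INR. fold t. nra. }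
      assert (hp : (t + 1) ^ (2 * k) <= 4 ^ k * t ^ (2 * k)).
      { rewrite !pow_mult, <- Rpow_mult_distr. apply pow_incr. split; [apply pow2_ge_0 | nra]. }
      assert (hP : 0 < (t + 1) ^ (2 * k)) by (apply pow_lt; lra).
      assert (hT : 0 < t ^ (2 * k)) by (apply pow_lt; lra).
      assert (hF : 0 < (t + 1) ^ 2) by (apply pow_lt; lra).
      apply Rle_trans with (l ^ 2 * C * 4 ^ k / (t + 1) ^ (2 * S k)).
      2: { apply Rmult_le_compat_r; [|lra]. apply Rlt_le, Rinv_0_lt_compat, pow_lt; lra. }
      replace (2 * S k)%nat with (2 + 2 * k)%nat by lia. rewrite pow_add.
      apply (Rmult_le_reg_r ((t + 1) ^ 2 * (t + 1) ^ (2 * k))); [now apply Rmult_lt_0_compat|].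
      replace (l ^ 2 * C * 4 ^ k / ((t + 1) ^ 2 * (t + 1) ^ (2 * k)) * ((t + 1) ^ 2 * (t + 1) ^
          (2 * k)))
        with ((l ^ 2 * (C / t ^ (2 * k))) * (4 ^ k * t ^ (2 * k))).
      2: { field. repeat split; lra. }
      rewrite <- Rmult_assoc.
      apply Rmult_le_compat; try lra.
      * apply Rmult_le_pos; lra.
      * apply Rle_trans with (eigenvalue (S r) * S1); [|lra].
        rewrite Rmult_comm. now apply Rmult_le_compat_r.
Qed.

(** * Extension of smooth functions *)

Definition clamp (l : R) (g : R -> R) (x : R) : R := g (Rmax 0 (Rmin x l)).

Lemma clamp_seg l g x : seg l x -> clamp l g x = g x.
Proof.
  intros [h0 h1]. unfold clamp. rewrite Rmin_left, Rmax_right by lra. reflexivity.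
Qed.

Lemma cont_clamp l g : 0 < l -> continuous_on_seg l g -> cont (clamp l g).
Proof.
  intros hl hg x. apply continuity_pt_filterlim.
  intros eps heps.
  set (cl := fun y => Rmax 0 (Rmin y l)).
  assert (hcl : forall y, seg l (cl y)).
  { intro y. unfold cl, seg, Rmax, Rmin. destruct (Rle_dec y l); destruct (Rle_dec 0 _); lra. }
  assert (hlip : forall y, Rabs (cl y - cl x) <= Rabs (y - x)).
  { intro y. unfold cl, Rmax, Rmin.
    destruct (Rle_dec y l), (Rle_dec x l); repeat destruct (Rle_dec 0 _);
      unfold Rabs; repeat destruct Rcase_abs; lra. }
  destruct (hg (cl x) (hcl x) eps heps) as (del & hdel & H).
  exists del. split; [exact hdel|].
  intros y [_ hy]. simpl in *. unfold Rdist in *.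
  destruct (Req_dec (cl y) (cl x)) as [E|E].
  - unfold clamp. fold (cl y) (cl x). rewrite E, Rminus_diag, Rabs_R0. exact heps.
  - apply (H (cl y)). split.
    + split; [apply hcl | auto].
    + eapply Rle_lt_trans; [apply hlip | exact hy].
Qed.

Lemma derivative_on_interior l (g g' : R -> R) x : derivative_on l g g' -> 0 < x < l ->
  is_derive g x (g' x).
Proof.
  intros hg hx. apply is_derive_Reals. intros eps heps.
  destruct (hg x (conj (Rlt_le _ _ (proj1 hx)) (Rlt_le _ _ (proj2 hx))) eps heps)
    as (del & hdel & H).
  assert (hm : 0 < Rmin del (Rmin x (l - x))) by (repeat apply Rmin_pos; lra).
  exists (mkposreal _ hm). intros h h0 hh. simpl in hh.
  assert (h1 := Rmin_l del (Rmin x (l - x))). assert (h2 := Rmin_r del (Rmin x (l - x))).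
  assert (h3 := Rmin_l x (l - x)). assert (h4 := Rmin_r x (l - x)).
  assert (h5 : Rabs h < x) by lra. assert (h6 : Rabs h < l - x) by lra.
  apply Rabs_def2 in h5. apply Rabs_def2 in h6.
  specialize (H (x + h)). simpl in H. unfold Rdist in H.
  replace (x + h - x) with h in H by ring.
  apply H. split; [|lra]. split; [split; lra | lra].
Qed.

Lemma interior_eq_locally l (g h : R -> R) x : 0 < x < l ->
  (forall y, 0 < y < l -> g y = h y) -> locally x (fun y => g y = h y).
Proof.
  intros hx H. apply (locally_interval _ x (Finite 0) (Finite l)); simpl; try lra.
  intros y h0 h1. apply H. split; assumption.
Qed.

(** The top derivative is extended by its endpoint values and then integrated
    back k times. *)
Lemma smooth_extension l k w : 0 < l -> C_k l k w ->
  exists W, smooth k W /\ forall x, seg l x -> W x = w x.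
Proof.
  intro hl. revert w. induction k as [|k IH]; intros w (d & h0 & hd & hc).
  - exists (clamp l (d O)). split.
    + apply cont_clamp; auto.
    + intros x hx. rewrite clamp_seg by exact hx. auto.
  - destruct (IH (d 1%nat)) as (V & hV & EV).
    { exists (fun i => d (S i)). split; [reflexivity|]. split.
      - intros i hi. apply (hd (S i)). lia.
      - intros i hi. apply hc. lia. }
    assert (cV := smooth_cont _ _ hV).
    set (W := fun x => w 0 + RInt V 0 x).
    assert (hW : forall x, is_derive W x (V x)) by (intro; now apply is_derive_primitive).
    exists W. split; [exists V; split; assumption|].
    intros x hx.
    assert (c0 : cont (clamp l (d O))) by (apply cont_clamp; [exact hl | apply hc; lia]).
    (* d 0 need not be continuous outside [0,l], so its clamped version is compared with W. *)
    destruct (MVT_gen (fun y => clamp l (d O) y + -1 * W y) 0 x (fun _ => 0)) as (c & _ & E).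
    + intros y hy. rewrite Rmin_left, Rmax_right in hy by (destruct hx; lra).
      assert (hy' : 0 < y < l) by (destruct hx; lra).
      evar_last.
      { apply is_derive_Rplus; [|apply is_derive_Rscal, hW].
        apply (is_derive_ext_loc (d O)).
        - apply (interior_eq_locally l); [exact hy'|].
          intros z hz. symmetry. apply clamp_seg. unfold seg. lra.
        - apply (derivative_on_interior l _ (d 1%nat)); [apply hd; lia | exact hy']. }
      rewrite EV by (unfold seg; lra). ring.
    + intros y _. apply continuity_pt_filterlim.
      apply (cont_plus (clamp l (d O)) (fun y => -1 * W y)); [exact c0|].
      assert (cW := cont_derivable _ _ hW). cont_tac.
    + assert (hs0 : seg l 0) by (unfold seg; lra).
      rewrite !clamp_seg in E by assumption. rewrite !h0 in E by assumption.
      assert (W0 : W 0 = w 0).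
      { unfold W. rewrite RInt_point. unfold zero; simpl. ring. }
      rewrite W0 in E. lra.
Qed.

(** The functions w1 and w2 witnessing the differential equation agree with the
    derivatives of the extension in the open interval, which is enough under
    integrals. *)
Lemma bvp_extension l a b f w W W' W'' : solves_bvp l a b f w ->
  (forall x, seg l x -> W x = w x) ->
  (forall x, is_derive W x (W' x)) -> (forall x, is_derive W' x (W'' x)) ->
  forall x, 0 < x < l -> a * W x - b * W'' x = f x.
Proof.
  intros ((w1 & w2 & hw1 & hw2 & hf) & _) E hW hW'.
  assert (E1 : forall x, 0 < x < l -> w1 x = W' x).
  { intros x hx. rewrite <- (is_derive_unique _ _ _ (hW x)). symmetry. apply is_derive_unique.
    apply (is_derive_ext_loc w).
    - apply (interior_eq_locally l); [exact hx|]. intros y hy. symmetry. apply E. unfold seg; lra.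
    - now apply (derivative_on_interior l). }
  assert (E2 : forall x, 0 < x < l -> w2 x = W'' x).
  { intros x hx. rewrite <- (is_derive_unique _ _ _ (hW' x)). symmetry. apply is_derive_unique.
    apply (is_derive_ext_loc w1).
    - apply (interior_eq_locally l); [exact hx | exact E1].
    - now apply (derivative_on_interior l). }
  intros x hx. rewrite <- E2, E by (unfold seg; lra). apply hf. unfold seg; lra.
Qed.

(** * Galerkin estimate *)

(** The same coefficients are combined with the phi_m for a trial function and
    with the legendre_hat l m for its derivative; the index starts at 1. *)
Fixpoint combination (al : nat -> R) (e : nat -> R -> R) (N : nat) (x : R) : R :=
  match N with
  | O => 0
  | S k => combination al e k x + al (S k) * e (S k) x
  end.

Lemma trial_combination l N al x : trial l N al x = combination al (phi l) N x.
Proof.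
  unfold trial. induction N as [|N IH].
  - rewrite sum_n_m_zero by lia. reflexivity.
  - rewrite sum_n_Sm by lia. rewrite IH. reflexivity.
Qed.

Lemma is_derive_phi l m x : is_derive (phi l m) x (legendre_hat l m x).
Proof.
  apply (is_derive_ext (fun y => 0 + RInt (legendre_hat l m) 0 y)).
  - intro t. unfold phi. apply Rplus_0_l.
  - apply is_derive_primitive. cont_tac.
Qed.

Lemma cont_phi l m : cont (phi l m).
Proof. exact (cont_derivable _ _ (is_derive_phi l m)). Qed.
#[export] Hint Resolve cont_phi : cont.

Lemma is_derive_combination l al N x :
  is_derive (combination al (phi l) N) x (combination al (legendre_hat l) N x).
Proof.
  induction N as [|N IH]; [apply @is_derive_const|].
  apply is_derive_Rplus; [exact IH|]. apply is_derive_Rscal, is_derive_phi.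
Qed.

Lemma cont_combination al e N : (forall m, cont (e m)) -> cont (combination al e N).
Proof.
  intro he. induction N as [|N IH]; [apply cont_const|].
  apply (cont_plus (combination al e N)); cont_tac.
Qed.

Lemma combination_minus al be e N x :
  combination (fun m => al m + -1 * be m) e N x
  = combination al e N x + -1 * combination be e N x.
Proof. induction N as [|N IH]; simpl; [|rewrite IH]; ring. Qed.

Lemma RInt_hat_mean l g : 0 < l -> cont g ->
  hat_scale l 0 * RInt g 0 l = wip l unit_weight (legendre_hat l 0) g.
Proof.
  intros hl cg. rewrite (wip_hat l 0 g cg). f_equal.
  apply RInt_ext. intros x _. unfold unit_weight, legendre_shift. simpl. ring.
Qed.

Lemma phi_0 l m : phi l m 0 = 0.
Proof. unfold phi. rewrite RInt_point. reflexivity. Qed.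

(** phi_m(l) is the integral of legendre_hat l m, which is orthogonal to the
    constants for m >= 1. *)
Lemma phi_l l m : 0 < l -> (1 <= m)%nat -> phi l m l = 0.
Proof.
  intros hl hm. apply (Rmult_eq_reg_l (hat_scale l 0)); [|now apply hat_scale_neq0].
  unfold phi. rewrite RInt_hat_mean by cont_tac. rewrite hat_orthonormal by exact hl.
  destruct (Nat.eq_dec 0 m); [lia | ring].
Qed.

Lemma combination_phi_0 l al N : combination al (phi l) N 0 = 0.
Proof. induction N as [|N IH]; simpl; [reflexivity|]. rewrite IH, phi_0. ring. Qed.

Lemma galerkin_combination l a b e e' al N : cont e -> cont e' -> 0 < l ->
  (forall m, (1 <= m <= N)%nat ->
     b * wip l unit_weight e' (legendre_hat l m) + a * wip l unit_weight e (phi l m) = 0) ->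
  b * wip l unit_weight e' (combination al (legendre_hat l) N)
    + a * wip l unit_weight e (combination al (phi l) N) = 0.
Proof.
  intros ce ce' hl. induction N as [|N IH]; intro H.
  - assert (Z : forall g, cont g -> wip l unit_weight g (fun _ => 0) = 0).
    { intros g cg. rewrite (wip_ext l unit_weight g _ g (fun x => 0 * unit_weight x));
        [|lra|reflexivity|intros; ring]. rewrite wip_scal_r by cont_tac. ring. }
    change (combination al (legendre_hat l) 0) with (fun _ : R => 0).
    change (combination al (phi l) 0) with (fun _ : R => 0).
    rewrite !Z by assumption. ring.
  - assert (c1 := cont_combination al (phi l) N (cont_phi l)).
    assert (c2 := cont_combination al (legendre_hat l) N (cont_hat l)).
    change (combination al (legendre_hat l) (S N)) with
      (fun x => combination al (legendre_hat l) N x + al (S N) * legendre_hat l (S N) x).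
    change (combination al (phi l) (S N)) with
      (fun x => combination al (phi l) N x + al (S N) * phi l (S N) x).
    rewrite !wip_lin_r by cont_tac.
    assert (E := IH ltac:(intros; apply H; lia)).
    assert (E1 := H (S N) ltac:(lia)).
    transitivity (0 + al (S N) * 0); [|ring]. rewrite <- E at 1. rewrite <- E1. ring.
Qed.

Lemma poincare l (g g' : R -> R) : 0 < l ->
  (forall x, is_derive g x (g' x)) -> cont g' -> g 0 = 0 ->
  sqnorm l g <= l ^ 2 * sqnorm l g'.
Proof.
  intros hl hg cg' g0. assert (cg := cont_derivable _ _ hg).
  apply Rle_trans with (wip l unit_weight (fun _ => l * sqnorm l g') unit_weight).
  - apply wip_le; try lra; try cont_tac.
    intros x hx. unfold unit_weight. rewrite Rmult_1_l, Rmult_1_r.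
    apply Rle_trans with (g x ^ 2); [apply Req_le; ring|].
    apply value_sq_le_energy; auto; lra.
  - apply Req_le. unfold wip, unit_weight at 1 2. rewrite RInt_const.
    unfold scal; simpl; unfold mult; simpl. ring.
Qed.

(** Cea's lemma as Pythagoras in the energy form: for e energy-orthogonal to d, the
    energy of e - d is the sum of the energies of e and d. *)
Lemma cea l a b (e e' d d' : R -> R) : 0 < l -> 0 < a -> 0 < b ->
  cont e -> cont e' -> cont d -> cont d' ->
  b * wip l unit_weight e' d' + a * wip l unit_weight e d = 0 ->
  b * sqnorm l e' <=
  b * sqnorm l (fun x => e' x + -1 * d' x) + a * sqnorm l (fun x => e x + -1 * d x).
Proof.
  intros hl ha hb ce ce' cd cd' H. unfold sqnorm. rewrite !wip_square by cont_tac.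
  assert (h1 := sqnorm_nonneg l e ltac:(lra) ce).
  assert (h2 := sqnorm_nonneg l d ltac:(lra) cd).
  assert (h3 := sqnorm_nonneg l d' ltac:(lra) cd').
  unfold sqnorm in *.
  set (p := wip l unit_weight e' d') in *. set (q := wip l unit_weight e d) in *.
  assert (0 <= a * wip l unit_weight e e) by (apply Rmult_le_pos; lra).
  assert (0 <= a * wip l unit_weight d d) by (apply Rmult_le_pos; lra).
  assert (0 <= b * wip l unit_weight d' d') by (apply Rmult_le_pos; lra).
  lra.
Qed.

(** The extension W of w satisfies the same weak equations as the trial function:
    multiply the differential equation by phi_m and integrate by parts. *)
Lemma galerkin_orthogonality l a b f w W W' W'' N al m : 0 < l ->
  solves_bvp l a b f w -> (forall x, seg l x -> W x = w x) ->
  (forall x, is_derive W x (W' x)) -> (forall x, is_derive W' x (W'' x)) -> cont W'' ->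
  ritz_galerkin l a b f N al -> (1 <= m <= N)%nat ->
  b * wip l unit_weight (fun x => combination al (legendre_hat l) N x + -1 * W' x)
      (legendre_hat l m)
  + a * wip l unit_weight (fun x => combination al (phi l) N x + -1 * W x) (phi l m) = 0.
Proof.
  intros hl hw EW hW hW' cW'' hRG hm.
  assert (cW := cont_derivable _ _ hW). assert (cW' := cont_derivable _ _ hW').
  assert (c1 := cont_combination al (phi l) N (cont_phi l)).
  assert (c2 := cont_combination al (legendre_hat l) N (cont_hat l)).
  assert (E := hRG m hm). rewrite !inner_weighted in E.
  rewrite (wip_ext l unit_weight (Derive (trial l N al)) _
    (combination al (legendre_hat l) N) (legendre_hat l m)) in E.
  2: lra.
  2: { intros x _. apply is_derive_unique.
       apply (is_derive_ext (combination al (phi l) N)).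
       - intro t. symmetry. apply trial_combination.
       - apply is_derive_combination. }
  2: { intros x _. apply is_derive_unique, is_derive_phi. }
  rewrite (wip_ext l unit_weight (trial l N al) _ (combination al (phi l) N) (phi l m)) in E;
    [|lra|intros; apply trial_combination|reflexivity].
  rewrite (wip_ext l unit_weight f _ (fun x => a * W x + (- b) * W'' x) (phi l m)) in E;
    [|lra| |reflexivity].
  2: { intros x hx. rewrite <- (bvp_extension l a b f w W W' W'') by assumption. ring. }
  rewrite wip_lin_l, wip_scal_l in E by cont_tac.
  rewrite (wip_by_parts l W' W'' (phi l m) (legendre_hat l m) hW' (is_derive_phi l m)) in E;
    try cont_tac.
  2: rewrite phi_0; ring.
  2: rewrite phi_l by (assumption || lia); ring.
  rewrite !wip_lin_l by cont_tac. lra.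
Qed.

(** [cea] compares the Galerkin solution with the combination of the phi_m whose
    coefficients are the Legendre coefficients of W'. *)
Lemma energy_bound l a b f w W W' W'' N al : 0 < l -> 0 < a -> 0 < b ->
  solves_bvp l a b f w -> (forall x, seg l x -> W x = w x) ->
  (forall x, is_derive W x (W' x)) -> (forall x, is_derive W' x (W'' x)) -> cont W'' ->
  ritz_galerkin l a b f N al ->
  b * sqnorm l (fun x => combination al (legendre_hat l) N x + -1 * W' x)
  <= (b + a * l ^ 2) * sqnorm l (remainder l W' (S N)).
Proof.
  intros hl ha hb hw EW hW hW' cW'' hRG.
  assert (cW := cont_derivable _ _ hW). assert (cW' := cont_derivable _ _ hW').
  assert (W0 : W 0 = 0). { rewrite EW by (unfold seg; lra). apply hw. }
  assert (Wl : W l = 0). { rewrite EW by (unfold seg; lra). apply hw. }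
  assert (cphi := fun c => cont_combination c (phi l) N (cont_phi l)).
  assert (chat := fun c => cont_combination c (legendre_hat l) N (cont_hat l)).
  set (c := coef l W').
  set (d := combination (fun m => al m + -1 * c m) (phi l) N).
  set (d' := combination (fun m => al m + -1 * c m) (legendre_hat l) N).
  set (z := fun x => combination c (phi l) N x + -1 * W x).
  set (z' := fun x => combination c (legendre_hat l) N x + -1 * W' x).
  assert (hz : forall x, is_derive z x (z' x)).
  { intro x. apply is_derive_Rplus; [apply is_derive_combination | apply is_derive_Rscal, hW]. }
  assert (cz : cont z') by (unfold z'; cont_tac).
  assert (hz' : sqnorm l z' = sqnorm l (remainder l W' (S N))).
  { assert (c0 : c O = 0).
    (* W' has mean zero, so dropping the constant Legendre term loses nothing. *)
    { unfold c, coef. rewrite <- RInt_hat_mean by assumption.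
      rewrite (RInt_derivative W W') by assumption. rewrite W0, Wl. ring. }
    assert (Ez : forall x, remainder l W' (S N) x = -1 * z' x).
    { intro x. unfold z'. clear - c0. induction N as [|N IH].
      - unfold remainder. simpl. fold c. rewrite c0. ring.
      - change (remainder l W' (S (S N)) x) with
          (remainder l W' (S N) x + - c (S N) * legendre_hat l (S N) x).
        rewrite IH. simpl. ring. }
    unfold sqnorm.
    rewrite (wip_ext l unit_weight (remainder l W' (S N)) _ (fun x => -1 * z' x)
        (fun x => -1 * z' x));
      [|lra|auto|auto].
    rewrite wip_scal_l, wip_scal_r by cont_tac. ring. }
  assert (H : b * wip l unit_weight (fun x => combination al (legendre_hat l) N x + -1 * W' x) d'
    + a * wip l unit_weight (fun x => combination al (phi l) N x + -1 * W x) d = 0).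
  { apply galerkin_combination; try cont_tac.
    intros m hm. now apply (galerkin_orthogonality l a b f w W W' W''). }
  apply cea in H; auto; try cont_tac; try (unfold d, d'; auto).
  eapply Rle_trans; [exact H|].
  assert (E1 : sqnorm l (fun x => combination al (legendre_hat l) N x + -1 * W' x + -1 * d' x)
      = sqnorm l z').
  { apply wip_ext; [lra| |]; intros; unfold d', z'; rewrite combination_minus; ring. }
  assert (E2 : sqnorm l (fun x => combination al (phi l) N x + -1 * W x + -1 * d x) = sqnorm l z).
  { apply wip_ext; [lra| |]; intros; unfold d, z; rewrite combination_minus; ring. }
  rewrite E1, E2, <- hz'.
  assert (P : sqnorm l z <= l ^ 2 * sqnorm l z').
  { apply poincare; auto. unfold z. rewrite combination_phi_0, W0. ring. }
  assert (a * sqnorm l z <= a * (l ^ 2 * sqnorm l z')) by (apply Rmult_le_compat_l; lra).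
  lra.
Qed.

Theorem mainTheorem5 (l a b : R) (hl : 0 < l) (ha : 0 < a) (hb : 0 < b)
  (f : R -> R) (hf : continuous_on_seg l f)
  (w : R -> R) (hw : solves_bvp l a b f w)
  (p : nat) (hp : (1 <= p)%nat) (hwp : C_k l (p + 1) w) :
  exists c : R, 0 < c /\
    forall (N : nat) (al : nat -> R), (1 <= N)%nat ->
      ritz_galerkin l a b f N al ->
      forall x : R, 0 <= x <= l ->
        Rabs (trial l N al x - w x)
        <= sqrt (l / 2) * (b2 l a b * c / Rpower (INR N) (INR p - 1 / 2)).
Proof.
  destruct (smooth_extension l (p + 1) w hl hwp) as (W & hsm & EW).
  rewrite Nat.add_1_r in hsm. destruct hsm as (W' & hW & hsm).
  destruct (remainder_rate l p hl W' hsm) as (C & hC & HC).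
  destruct p as [|p]; [lia|]. destruct hsm as (W'' & hW' & hsm).
  assert (cW'' := smooth_cont _ _ hsm).
  assert (cW := cont_derivable _ _ hW). assert (cW' := cont_derivable _ _ hW').
  (* K / N^(2p) bounds the squared error; c cancels the factors sqrt(l/2) and b2. *)
  set (K := l * (b + a * l ^ 2) / b * C).
  assert (hal : 0 < b + a * l ^ 2).
  { assert (0 < a * l ^ 2) by (apply Rmult_lt_0_compat; [lra | apply pow_lt; lra]). lra. }
  assert (hfac : 0 < l * (b + a * l ^ 2) / b).
  { apply Rdiv_lt_0_compat; [now apply Rmult_lt_0_compat | lra]. }
  assert (hK : 0 <= K) by (apply Rmult_le_pos; lra).
  assert (hl2 : 0 < sqrt (l / 2)) by (apply sqrt_lt_R0; lra).
  assert (hb2 : 0 < b2 l a b).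
  { apply sqrt_lt_R0. assert (hPI := PI_RGT_0).
    assert (0 < a * l ^ 2 / (b * PI ^ 2)); [|lra].
    apply Rdiv_lt_0_compat; apply Rmult_lt_0_compat; try lra; apply pow_lt; lra. }
  exists ((sqrt K + 1) / (sqrt (l / 2) * b2 l a b)).
  assert (hsK := sqrt_pos K).
  split. { apply Rdiv_lt_0_compat; [lra | now apply Rmult_lt_0_compat]. }
  intros N al hN hRG x hx.
  assert (hN1 : 1 <= INR N) by (apply (le_INR 1); lia).
  set (e := fun y => combination al (phi l) N y + -1 * W y).
  set (e' := fun y => combination al (legendre_hat l) N y + -1 * W' y).
  assert (he : forall y, is_derive e y (e' y)).
  { intro y. apply is_derive_Rplus; [apply is_derive_combination | apply is_derive_Rscal, hW]. }
  assert (ce' : cont e').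
  { assert (H := cont_combination al (legendre_hat l) N (cont_hat l)). unfold e'. cont_tac. }
  assert (e0 : e 0 = 0).
  { unfold e. rewrite combination_phi_0, EW by (unfold seg; lra).
    rewrite (proj1 (proj2 hw)). ring. }
  replace (trial l N al x - w x) with (e x).
  2: { unfold e. rewrite trial_combination, EW by exact hx. ring. }
  assert (h1 := value_sq_le_energy l e e' x he ce' (proj1 hx) (proj2 hx) e0).
  assert (h2 := energy_bound l a b f w W W' W'' N al hl ha hb hw EW hW hW' cW'' hRG).
  fold e' in h2.
  assert (h3 := HC (S N) ltac:(lia)).
  assert (hpow : 0 < INR N ^ S p) by (apply pow_lt; lra).
  assert (h4 : C / INR (S N) ^ (2 * S p) <= C / (INR N ^ S p) ^ 2).
  { rewrite <- pow_mult, (Nat.mul_comm (S p)). apply Rmult_le_compat_l; [exact hC|].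
    apply Rinv_le_contravar; [apply pow_lt; lra|].
    apply pow_incr. rewrite S_INR. lra. }
  assert (h5 : e x ^ 2 <= (sqrt K / INR N ^ S p) ^ 2).
  { replace ((sqrt K / INR N ^ S p) ^ 2) with ((sqrt K * sqrt K) / (INR N ^ S p) ^ 2)
      by (field; lra).
    rewrite sqrt_sqrt by exact hK.
    replace (K / (INR N ^ S p) ^ 2) with
      (l * ((b + a * l ^ 2) * (C / (INR N ^ S p) ^ 2) / b)) by (unfold K; field; lra).
    eapply Rle_trans; [exact h1|]. apply Rmult_le_compat_l; [lra|].
    apply (Rmult_le_reg_l b); [lra|].
    replace (b * ((b + a * l ^ 2) * (C / (INR N ^ S p) ^ 2) / b)) with
      ((b + a * l ^ 2) * (C / (INR N ^ S p) ^ 2)) by (field; lra).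
    eapply Rle_trans; [exact h2|]. apply Rmult_le_compat_l; lra. }
  assert (h6 : Rabs (e x) <= sqrt K / INR N ^ S p).
  { rewrite <- (Rabs_pos_eq (sqrt K / INR N ^ S p)).
    - apply Rsqr_le_abs_0. rewrite !Rsqr_pow2. exact h5.
    - apply Rmult_le_pos; [lra|]. apply Rlt_le, Rinv_0_lt_compat; lra. }
  set (P := Rpower (INR N) (INR (S p) - 1 / 2)).
  assert (hP0 : 0 < P) by apply exp_pos.
  assert (hP : P <= INR N ^ S p).
  { rewrite <- Rpower_pow by lra. destruct (Req_dec (INR N) 1) as [E|E].
    - unfold P. rewrite E. unfold Rpower. rewrite ln_1, !Rmult_0_r. lra.
    - apply Rlt_le, Rpower_lt; lra. }
  replace (sqrt (l / 2) * (b2 l a b * ((sqrt K + 1) / (sqrt (l / 2) * b2 l a b)) / P))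
    with ((sqrt K + 1) / P) by (field; lra).
  eapply Rle_trans; [exact h6|].
  apply Rmult_le_compat; try lra.
  - apply Rlt_le, Rinv_0_lt_compat; lra.
  - apply Rinv_le_contravar; lra.
Qed.
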